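(* Let $p$ be an odd prime, let $g$ be a (fixed) primitive root modulo $p^2$ with $q_p(g)=\delta$ (so $1\le\delta<p$), and let $\beta\in\overline{\mathbb{F}}_2$ be a primitive $p^2$-th root of unity. Let $\lambda$ be the smallest positive integer satisfying $2^\lambda\equiv 1\pmod p$. Let $(e_u)$ be the binary threshold sequence defined, for $u\ge 0$, by $e_u=0$ if $0\le q_p(u)/p<\frac12$ and $e_u=1$ if $\frac12\le q_p(u)/p<1$. For $0\le j<p$ put $$\eta_j=\sum_{l=\frac{p+1}{2}}^{p-1}D_{l+j\delta}(\beta).$$ If $2^{p-1}\not\equiv 1\pmod{p^2}$, then for all $u\ge 0$ $$e_u=\frac{p-1}{2}\sum_{k=0}^{\frac{p-1}{\lambda}-1}\mathrm{Tr}^{\lambda}_1\left(\beta^{upg^k}\right)+\sum_{j=0}^{p-1}\eta_j\sum_{k=0}^{\frac{p-1}{\lambda}-1}\mathrm{Tr}^{\lambda p}_p\left(\beta^{ug^{kp+j}}\right),$$ and otherwise (that is, if $2^{p-1}\equiv 1\pmod{p^2}$), for all $u\ge 0$ $$e_u=\frac{p-1}{2}\sum_{k=0}^{\frac{p-1}{\lambda}-1}\mathrm{Tr}^{\lambda}_1\left(\beta^{upg^k}\right)+\sum_{j=0}^{p-1}\eta_j\sum_{k=0}^{\frac{p-1}{\lambda}-1}\mathrm{Tr}^{\lambda}_1\left(\beta^{ug^{kp+j}}\right).$$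
   Context: Fermat quotient: for an odd prime $p$ and an integer $u$ with $\gcd(u,p)=1$, $q_p(u)$ is the unique integer with $q_p(u)\equiv\frac{u^{p-1}-1}{p}\pmod p$ and $0\le q_p(u)\le p-1$; moreover $q_p(kp)=0$ for all $k\in\mathbb{Z}$. $\mathbb{F}_2=\{0,1\}$ is the binary field and $\overline{\mathbb{F}}_2$ its algebraic closure. All identities for sequence values are in $\overline{\mathbb{F}}_2$, with $e_u\in\mathbb{F}_2\subset\overline{\mathbb{F}}_2$ and integers such as $\frac{p-1}{2}$ read modulo 2. For $l=0,1,\ldots,p-1$ let $D_l=\{u:0\le u<p^2,\ \gcd(u,p)=1,\ q_p(u)=l\}$, with the subscript of $D$ taken modulo $p$ (so $D_{l+p}=D_l$), and let $D_l(x)=\sum_{u\in D_l}x^u\in\mathbb{F}_2[x]$. For $k\mid n$, the trace function from $\mathbb{F}_{2^n}$ to $\mathbb{F}_{2^k}$ is $\mathrm{Tr}^n_k(x)=x+x^{2^k}+x^{2^{2k}}+\cdots+x^{2^{(n/k-1)k}}$. *)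

(* Defs.v *)
From mathcomp Require Export all_boot all_algebra.

Set Implicit Arguments.
Unset Strict Implicit.
Unset Printing Implicit Defensive.

Import GRing.Theory.
Local Open Scope ring_scope.

(* For u prime to p, Fermat's little theorem makes the inner division exact;
   [%% p] then selects the representative in [0, p - 1]. *)
Definition fermat_quotient (p : nat) (u : int) : int :=
  if coprimez u p then (((u ^+ p.-1 - 1) %/ p)%Z %% p)%Z else 0.

(* For p prime, 0 <= fermat_quotient p u / p < 1 always holds, so the two cases
   are q_p(u)/p in [0, 1/2) and q_p(u)/p in [1/2, 1). *)
Definition threshold_seq (p u : nat) : 'F_2 :=
  if (fermat_quotient p u%:Z)%:~R / p%:R < 2%:R^-1 :> rat then 0 else 1.

(* The index l is read modulo p. *)
Definition fermat_class (p l : nat) : {set 'I_(p ^ 2)} :=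
  [set u : 'I_(p ^ 2) | coprime u p
                        && (fermat_quotient p (u : nat)%:Z == (l %% p)%N%:Z)].

Definition fermat_class_poly (p l : nat) : {poly 'F_2} :=
  \sum_(u in fermat_class p l) 'X^u.

(* The trace from F_(2^n) to F_(2^k), for k dividing n, given by its defining
   formula on an ambient field K containing F_(2^n). *)
Definition trace2 (K : fieldType) (n k : nat) (x : K) : K :=
  \sum_(i < n %/ k) x ^+ (2 ^ (i * k)).

(* g generates the unit group of Z/n (n > 1): its class has multiplicative
   order exactly totient n. *)
Definition primitive_root_mod (n : nat) (g : int) : bool :=
  (totient n).-primitive_root (g%:~R : 'Z_n).

Section Eta.

Variables (K : fieldType) (iota : {rmorphism 'F_2 -> K}).

Definition eval2 (P : {poly 'F_2}) (x : K) : K := (map_poly iota P).[x].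

Definition eta (p delta : nat) (beta : K) (j : nat) : K :=
  \sum_(p.+1./2 <= l < p) eval2 (fermat_class_poly p (l + j * delta)) beta.

End Eta.

(* Main.v *)
Require Import Defs.
From mathcomp Require Import ring zify.

Set Implicit Arguments.
Unset Strict Implicit.
Unset Printing Implicit Defensive.

Import GRing.Theory Num.Theory.
Local Open Scope ring_scope.

(* Work in Z/p^2, where a unit u has Fermat quotient l mod p exactly when
   u^(p-1) = 1 + p l; this makes q_p additive on products, so that D_(l + m) is
   a D_l for every a in D_m.  With h = 2^p in Z/p^2, which has order lambda, the
   cosets of <h> in <g^p> turn the inner double sums (over k and over the trace)
   into sums over g^j <g^p>, that is over the class D_(j delta); in the Wieferich
   case 2 = h in Z/p^2, so both cases are the same computation.  The second term
   is then
     sum_(v | e_v = 1) sum_(a unit) beta^(a (u + v)),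
   and in characteristic 2 the sum of beta^(a z) over the units a is
   [z = 0] - [p z = 0].  Since -1 lies in D_0 and each D_l meets each nonzero
   residue class mod p exactly once, this equals e_u plus (p - 1)/2 times
   [p does not divide u]; the first term of the formula cancels the excess. *)

(** * Reindexing finite sums, in particular over cosets in a cyclic group *)

Lemma sum_inj_card (V : nmodType) (I T : finType) (A : {pred T})
    (f : I -> T) (F : T -> V) :
  injective f -> (forall i, f i \in A) -> #|A| = #|I| ->
  \sum_(x in A) F x = \sum_i F (f i).
Proof.
move=> f_inj fA cardA.
have AE : A =i codom f.
  apply/fsym/subset_cardP; first by rewrite card_codom.
  by apply/subsetP => _ /codomP[i ->].
rewrite (eq_bigl _ _ AE) -big_uniq ?big_image //.
by rewrite map_inj_uniq ?enum_uniq.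
Qed.

Lemma sum_ord_mul (V : nmodType) (m n l : nat) (F : nat -> V) :
  l = (m * n)%N ->
  \sum_(k < l) F k = \sum_(i < m) \sum_(j < n) F (i * n + j)%N.
Proof.
move=> ->; rewrite -(big_mkord xpredT F) big_nat_mul big_mkord; apply: eq_bigr => i _.
rewrite mulSn -{1}[(i * n)%N]add0n big_addn addnK big_mkord.
by apply: eq_bigr => j _; rewrite addnC.
Qed.

Lemma prim_root_unit (R : comUnitRingType) n (z : R) :
  n.-primitive_root z -> z \is a GRing.unit.
Proof.
move=> prim_z; apply/unitrPr; exists (z ^+ n.-1).
by rewrite -exprS prednK ?(prim_expr_order prim_z) ?(prim_order_gt0 prim_z).
Qed.

(** The products [z ^+ k * h ^+ i] run once through the powers of [z]: they are powers of [z]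
    because [h] is one, there are [n] of them, and they are distinct since an [l]-th power removes
    [h] and determines [k]. *)
Lemma sum_cosets (V : nmodType) (R : finComUnitRingType) (n l : nat) (z h : R)
    (F : R -> V) :
  n.-primitive_root z -> l.-primitive_root h -> (l %| n)%N ->
  (exists b, h = z ^+ b) ->
  \sum_(k < n %/ l) \sum_(i < l) F (z ^+ k * h ^+ i) = \sum_(k < n) F (z ^+ k).
Proof.
move=> prim_z prim_h ln [b hE].
have l_gt0 := prim_order_gt0 prim_h.
have zinj : injective (fun k : 'I_n => z ^+ k).
  move=> i j /eqP; rewrite (eq_prim_root_expr prim_z) !modn_small //.
  by move=> /eqP/val_inj.
pose A := codom (fun k : 'I_n => z ^+ k).
have zA k : z ^+ k \in A.
  rewrite -(prim_expr_mod prim_z).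
  exact: (codom_f (fun k : 'I_n => z ^+ k)
            (Ordinal (ltn_pmod k (prim_order_gt0 prim_z)))).
transitivity (\sum_(x in A) F x); last first.
  rewrite -big_uniq ?big_image /=; last by rewrite map_inj_uniq ?enum_uniq.
  exact: eq_bigl.
rewrite pair_big /=; symmetry.
apply: (sum_inj_card (f := fun ki : 'I_(n %/ l) * 'I_l => z ^+ ki.1 * h ^+ ki.2)).
- move=> [k i] [k' i'] /= E.
  have Ek : k = k'.
    move: (congr1 (fun x => x ^+ l) E).
    rewrite !exprMn -!exprM -![(_ * l)%N]mulnC !(exprM h).
    rewrite (prim_expr_order prim_h) !expr1n !mulr1.
    move/eqP; rewrite (eq_prim_root_expr prim_z) !modn_small; last 2 first.
    - by rewrite mulnC -[X in (_ < X)%N](divnK ln) ltn_pmul2r.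
    - by rewrite mulnC -[X in (_ < X)%N](divnK ln) ltn_pmul2r.
    by rewrite eqn_pmul2l // => /eqP/val_inj.
  congr (_, _) => //; move: E; rewrite Ek.
  move/(mulrI (unitrX k' (prim_root_unit prim_z)))/eqP.
  rewrite (eq_prim_root_expr prim_h) !modn_small //.
  by move/eqP/val_inj.
- by move=> [k i] /=; rewrite hE -exprM -exprD; apply: zA.
- by rewrite card_codom // card_prod !card_ord divnK.
Qed.

(** * Arithmetic in Z/p^2 and levels of the Fermat quotient *)

Section Arith.

Variables (p : nat) (p_pr : prime p).

Local Notation N := (p ^ 2)%N.
Local Notation Z := 'Z_(p ^ 2).

Let p_gt1 : (1 < p)%N := prime_gt1 p_pr.
Let p_gt0 : (0 < p)%N := prime_gt0 p_pr.

Lemma sqr_prime_gt1 : (1 < N)%N.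
Proof. by rewrite -[1%N](expn0 p) ltn_exp2l. Qed.
Local Notation N_gt1 := sqr_prime_gt1.

Lemma natZ_eq (a b : nat) : (a%:R == b%:R :> Z) = (a == b %[mod N]).
Proof. by rewrite -val_eqE /= !(val_Zp_nat N_gt1). Qed.

Lemma natZ_val (x : Z) : exists2 a : nat, (a < N)%N & x = a%:R.
Proof.
exists x; last by rewrite natr_Zp.
by rewrite -[X in (_ < X)%N](Zp_cast N_gt1) ltn_ord.
Qed.

Lemma mulpp : p%:R * p%:R = 0 :> Z.
Proof. by rewrite -natrM mulnn (pchar_Zp N_gt1). Qed.

Lemma mulp_nat_eq (a b : nat) :
  (p%:R * a%:R == p%:R * b%:R :> Z) = (a == b %[mod p]).
Proof. by rewrite -!natrM natZ_eq -mulnn -!muln_modr eqn_pmul2l. Qed.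

Lemma mulp_nat_eq0 (a : nat) : (p%:R * a%:R == 0 :> Z) = (p %| a)%N.
Proof. by rewrite -[0](mulr0 p%:R) (mulp_nat_eq a 0) mod0n. Qed.

Lemma unitZE (x : Z) : (x \is a GRing.unit) = (p%:R * x != 0).
Proof.
have [a _ ->] := natZ_val x.
by rewrite mulp_nat_eq0 (unitZpE _ N_gt1) coprime_pexpl // prime_coprime.
Qed.

(** Multiplication by [p] sees only residues modulo [p], so this is Fermat's little theorem without
    leaving Z/p^2. *)
Lemma mulp_exprp (x : Z) : p%:R * x ^+ p = p%:R * x.
Proof.
have [a _ ->] := natZ_val x.
by apply/eqP; rewrite -natrX mulp_nat_eq fermat_little.
Qed.

Lemma mulp_congrX (x y : Z) n : p%:R * x = p%:R * y -> p%:R * x ^+ n = p%:R * y ^+ n.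
Proof.
move=> E; elim: n => // n IH.
by rewrite !exprS mulrA E -mulrA mulrCA IH mulrCA.
Qed.

Lemma mulp_eq0P (x : Z) : p%:R * x = 0 -> exists2 t, (t < p)%N & x = p%:R * t%:R.
Proof.
have [a aN ->] := natZ_val x.
move/eqP; rewrite mulp_nat_eq0 => /dvdnP[t aE]; exists t.
  by move: aN; rewrite aE -mulnn ltn_pmul2r.
by rewrite aE mulnC natrM.
Qed.

(** In [x ^+ p - y ^+ p] the factor [x - y] is a multiple of [p]; after it, each of the [p] terms of
    the cofactor may be replaced by [y ^+ p.-1], which yields a second factor [p]. *)
Lemma exprp_congr (x y : Z) : p%:R * x = p%:R * y -> x ^+ p = y ^+ p.
Proof.
move=> E; apply/eqP; rewrite -subr_eq0; apply/eqP; rewrite subrXX.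
have [|t _ ->] := @mulp_eq0P (x - y); first by rewrite mulrBr E subrr.
rewrite mulrAC mulr_sumr.
rewrite (eq_bigr (fun _ => p%:R * y ^+ p.-1)); last first.
  move=> i _; rewrite mulrA (mulp_congrX _ E) -mulrA -exprD.
  by congr (_ * _ ^+ _); have := ltn_ord i; lia.
by rewrite sumr_const card_ord -mulrnAl -mulrnA mulnn (pchar_Zp N_gt1) !mul0r.
Qed.

Lemma expr1Dp (x : Z) n : (1 + p%:R * x) ^+ n = 1 + n%:R * (p%:R * x).
Proof.
elim: n => [|n IH]; first by rewrite expr0 mul0r addr0.
have := mulpp; rewrite exprS IH -natr1 => pp.
transitivity (1 + (n%:R + 1) * (p%:R * x) + (p%:R * p%:R) * (n%:R * x ^+ 2)).
  by ring.
by rewrite pp mul0r addr0.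
Qed.

(** Division-free form of the condition that the Fermat quotient of [x] is [l] modulo [p]. It forces
    [x] to be a unit, so the conventional value 0 on multiples of [p] never counts here. *)
Definition fq_level (x : Z) (l : nat) : bool := x ^+ p.-1 == 1 + p%:R * l%:R.

Lemma fq_level_unit x l : fq_level x l -> x \is a GRing.unit.
Proof.
move=> /eqP E; rewrite -(@unitrX_pos _ _ p.-1); last by rewrite -ltnS prednK.
rewrite E; apply/unitrPr; exists (1 - p%:R * l%:R).
transitivity (1 - p%:R * p%:R * (l%:R * l%:R) : Z); first by ring.
by rewrite mulpp mul0r subr0.
Qed.

Lemma fq_levelM x y l m : fq_level x l -> fq_level y m -> fq_level (x * y) (l + m).
Proof.
move=> /eqP xl /eqP ym; rewrite /fq_level exprMn xl ym natrD; apply/eqP.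
transitivity (1 + p%:R * (l%:R + m%:R) + p%:R * p%:R * (l%:R * m%:R) : Z); first by ring.
by rewrite mulpp mul0r addr0.
Qed.

Lemma fq_levelX x l n : fq_level x l -> fq_level (x ^+ n) (n * l).
Proof.
move=> xl; elim: n => [|n IH]; first by rewrite /fq_level expr0 mul0n mulr0 addr0 expr1n.
by rewrite exprS mulSn; apply: fq_levelM.
Qed.

Lemma fq_level_uniq x l m : fq_level x l -> fq_level x m = (l == m %[mod p]).
Proof.
by move=> /eqP xl; rewrite /fq_level xl (inj_eq (addrI 1)) mulp_nat_eq.
Qed.

Lemma fq_levelMl x y l m : fq_level x l -> fq_level (x * y) (m + l) = fq_level y m.
Proof.
move=> xl; apply/idP/idP; last by rewrite addnC => /(fq_levelM xl).
have xu := fq_level_unit xl.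
move/eqP: xl; rewrite /fq_level exprMn natrD => -> /eqP E; apply/eqP.
have : (1 + p%:R * l%:R) * (y ^+ p.-1) = (1 + p%:R * l%:R) * (1 + p%:R * m%:R).
  rewrite E; apply/esym.
  transitivity (1 + p%:R * (m%:R + l%:R) + p%:R * p%:R * (l%:R * m%:R) : Z).
    by ring.
  by rewrite mulpp mul0r addr0.
(* The factor [1 + p l] has [p.-1]-th power [1 + p (p-1) l], so it has a level and is a unit. *)
apply: mulrI; apply: (@fq_level_unit _ (p.-1 * l)).
by rewrite /fq_level expr1Dp natrM mulrCA.
Qed.

Lemma fq_levelN x l : odd p -> fq_level (- x) l = fq_level x l.
Proof.
by move=> po; rewrite /fq_level exprNn -signr_odd -subn1 oddB // po mul1r.
Qed.

(** By Fermat, [p] annihilates [x ^+ p.-1 - 1], which is therefore a multiple of [p]. *)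
Lemma unit_has_level (x : Z) : x \is a GRing.unit -> exists2 l, (l < p)%N & fq_level x l.
Proof.
move=> xu; have E : p%:R * (x ^+ p.-1 - 1) = 0.
  apply: (mulIr xu); rewrite mul0r -mulrA mulrBl mul1r -exprSr prednK //.
  by rewrite mulrBr mulp_exprp subrr.
have [t tp tE] := mulp_eq0P E.
by exists t => //; rewrite /fq_level -tE addrC subrK.
Qed.

(* [y] congruent to [x] mod p forces [x ^+ p = y ^+ p = y * (1 + p * l)]. *)
Lemma sum_fq_level_congr (V : nmodType) (x : Z) l (c : V) : x \is a GRing.unit ->
  \sum_(y | fq_level y l && (p%:R * y == p%:R * x)) c = c.
Proof.
move=> xu; rewrite (big_pred1 (x ^+ p * (1 + p%:R * - l%:R))) // => y.
have x1 : (x ^+ p) ^+ p.-1 = 1.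
  have [m _ xm] := unit_has_level xu.
  have /eqP := fq_levelX p xm; rewrite natrM mulrA mulpp mul0r addr0 => ->.
  by [].
have pp := mulpp.
apply/andP/eqP => [[/eqP yl /eqP yx]|->].
  have yE : y ^+ p = y * (1 + p%:R * l%:R) by rewrite -yl -exprS prednK.
  rewrite -(exprp_congr yx) yE.
  transitivity (y + p%:R * p%:R * (- y * l%:R * l%:R)); last by ring.
  by rewrite pp mul0r addr0.
split; last first.
  apply/eqP; rewrite mulrA mulp_exprp.
  transitivity (p%:R * x + p%:R * p%:R * (- x * l%:R)); first by ring.
  by rewrite pp mul0r addr0.
rewrite /fq_level exprMn x1 mul1r expr1Dp; apply/eqP; congr (_ + _).
transitivity (p%:R * l%:R - (p.-1%:R + 1) * p%:R * l%:R : Z); first by ring.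
by rewrite natr1 prednK // pp mul0r subr0.
Qed.

End Arith.

Arguments fq_level p x l : clear implicits.

(** * From integer Fermat quotients to levels in Z/p^2 *)

Section FermatQuotient.

Variables (p : nat) (p_pr : prime p).

Local Notation N := (p ^ 2)%N.
Local Notation Z := 'Z_(p ^ 2).

Let p_gt0 : (0 < p)%N := prime_gt0 p_pr.

Lemma natZ_coprime (a : nat) : (a%:R : Z) \is a GRing.unit = coprime a p.
Proof. by rewrite (unitZpE _ (sqr_prime_gt1 p_pr)) coprime_pexpl // coprime_sym. Qed.

Lemma intZ_coprime (u : int) : (u%:~R : Z) \is a GRing.unit = coprimez u p.
Proof.
by case: u => n; rewrite ?NegzE ?mulrNz ?unitrN -pmulrn natZ_coprime.
Qed.

Lemma fermat_quotient_spec (u : int) : coprimez u p ->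
  exists q : nat, [/\ fermat_quotient p u = q, (q < p)%N & fq_level p u%:~R q].
Proof.
move=> cup; rewrite /fermat_quotient cup.
set m := ((u ^+ p.-1 - 1) %/ p)%Z.
have pnz : p%:Z != 0 by rewrite eqz_nat -lt0n.
have q_ge0 : (0 <= m %% p)%Z by rewrite modz_ge0.
have q_lt : (m %% p < p)%Z by rewrite ltz_pmod.
have dv : (p %| u ^+ p.-1 - 1)%Z.
  have chF : p \in [pchar 'F_p] by apply: pchar_Fp.
  rewrite (dvdz_pcharf chF) rmorphB rmorphXn /= subr_eq0.
  have un0 : (u%:~R : 'F_p) != 0.
    rewrite -(dvdz_pcharf chF) dvdzE -prime_coprime //=.
    by rewrite coprime_sym.
  apply/eqP/(mulfI un0); rewrite -exprS prednK // mulr1.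
  have := pFrobenius_aut_int chF u; rewrite pFrobenius_autE => ->.
  by [].
case E: (m %% p)%Z q_ge0 q_lt => [q|//] _ qp; exists q; split=> //; rewrite /fq_level.
(* Division of [m] by [p] with remainder [q], multiplied by [p]; the first term is a multiple of p^2
   and vanishes in Z/p^2. *)
have : u ^+ p.-1 - 1 = p%:Z * (m %/ p)%Z * p%:Z + p%:Z * q%:Z.
  by rewrite -mulrA -mulrDr -E -divz_eq mulrC divzK.
move/(congr1 (fun x : int => x%:~R : Z)).
rewrite rmorphB rmorphD !rmorphM /= rmorphXn /= rmorph1 mulrAC -!pmulrn.
by rewrite (mulpp p_pr) mul0r add0r => /eqP; rewrite subr_eq addrC.
Qed.

Lemma fermat_classE (u l : nat) :
  coprime u p && (fermat_quotient p u%:Z == (l %% p)%N%:Z) = fq_level p u%:R l.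
Proof.
case cup: (coprime u p) => /=; last first.
  apply/esym/negbTE/negP => /(fq_level_unit p_pr).
  by rewrite natZ_coprime cup.
have [q [-> qp lq]] := @fermat_quotient_spec u%:Z cup.
by rewrite -pmulrn in lq; rewrite (fq_level_uniq p_pr _ lq) eqz_nat (modn_small qp).
Qed.

Lemma fermat_quotient_level (u : int) q :
  (u%:~R : Z) \is a GRing.unit -> fermat_quotient p u = q%:Z -> fq_level p u%:~R q.
Proof. by rewrite intZ_coprime => /fermat_quotient_spec[r [-> _ ur]] [<-]. Qed.

(** The bound [p.+1./2] is p/2 rounded up, and at most one level of the range fits [u]. For [u]
    divisible by [p] both sides are 0: the quotient is 0 by convention and no level fits. *)
Lemma threshold_seqE (u : nat) :
  threshold_seq p u = \sum_(p.+1./2 <= l < p) (fq_level p u%:R l)%:R.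
Proof.
rewrite /threshold_seq.
case cup: (coprimez u%:Z p); last first.
  rewrite /fermat_quotient cup /= mul0r big1 // => l _.
  by rewrite -fermat_classE -[coprime _ _]/(coprimez u%:Z p) cup.
have [q [-> qp lq]] := fermat_quotient_spec cup.
rewrite -pmulrn in lq.
have -> : \sum_(p.+1./2 <= l < p) (fq_level p u%:R l)%:R
          = \sum_(p.+1./2 <= l < p) (q == l)%:R :> 'F_2.
  by apply: eq_big_nat => l /andP[_ lp]; rewrite (fq_level_uniq p_pr _ lq) !modn_small.
have -> : (q%:~R / p%:R < 2%:R^-1 :> rat) = (q.*2 < p)%N.
  rewrite -pmulrn ltr_pdivrMr ?ltr0n // mulrC ltr_pdivlMr ?ltr0n //.
  by rewrite -natrM ltr_nat muln2.
case: ltnP => qlt.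
  rewrite big_nat big1 // => l /andP[lo hi].
  by have /negbTE-> : q != l by move: lo; lia.
rewrite (bigD1_seq q) ?iota_uniq //=; last by rewrite mem_index_iota qp andbT; lia.
rewrite eqxx big1 ?addr0 // => l /negbTE; by rewrite eq_sym => ->.
Qed.

End FermatQuotient.

(** * Sums of an additive character of Z/p^2 in characteristic 2 *)

Section Character.

Variables (K : fieldType) (chK : 2 \in [pchar K]).
Variables (p : nat) (p_pr : prime p) (p_odd : odd p).
Variables (beta : K) (beta_prim : (p ^ 2)%N.-primitive_root beta).

Local Notation N := (p ^ 2)%N.
Local Notation Z := 'Z_(p ^ 2).

Let p_gt0 : (0 < p)%N := prime_gt0 p_pr.
Let N_gt1 : (1 < N)%N := sqr_prime_gt1 p_pr.

Definition zeta (x : Z) : K := beta ^+ x.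

Lemma zeta_nat (n : nat) : zeta n%:R = beta ^+ n.
Proof. by rewrite /zeta (val_Zp_nat N_gt1) (prim_expr_mod beta_prim). Qed.

Lemma zetaD x y : zeta (x + y) = zeta x * zeta y.
Proof.
have [a _ ->] := natZ_val p_pr x; have [b _ ->] := natZ_val p_pr y.
by rewrite -natrD !zeta_nat exprD.
Qed.

Lemma zetaM_nat x n : zeta (x * n%:R) = zeta x ^+ n.
Proof. by have [a _ ->] := natZ_val p_pr x; rewrite -natrM !zeta_nat exprM. Qed.

Lemma zeta_eq1 x : (zeta x == 1) = (x == 0).
Proof.
have [a _ ->] := natZ_val p_pr x.
by rewrite zeta_nat -(prim_order_dvd beta_prim) -[0]/(0%:R) (natZ_eq p_pr) mod0n.
Qed.

Lemma zeta_int (z : int) : beta ^ z = zeta z%:~R.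
Proof.
case: z => n; first by rewrite -exprnP -pmulrn zeta_nat.
have nz : beta ^+ n.+1 != 0.
  have : zeta n.+1%:R * zeta (- n.+1%:R) = 1.
    by rewrite -zetaD subrr; apply/eqP; rewrite zeta_eq1.
  rewrite zeta_nat => E; apply/eqP => E0; move/eqP: E.
  by rewrite E0 mul0r eq_sym oner_eq0.
apply: (mulfI nz); rewrite NegzE -exprnN divff //.
rewrite -zeta_nat -zetaD mulrNz -pmulrn subrr.
by apply/esym/eqP; rewrite zeta_eq1.
Qed.

Lemma sum_Zp (V : nmodType) (F : Z -> V) : \sum_x F x = \sum_(i < N) F i%:R.
Proof.
transitivity (\sum_(0 <= i < (Zp_trunc N).+2) F i%:R).
  by rewrite big_mkord; apply: eq_bigr => x _; rewrite natr_Zp.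
by rewrite [X in index_iota 0 X](Zp_cast N_gt1) big_mkord.
Qed.

Lemma natr_pchar2 n : n%:R = (odd n)%:R :> K.
Proof.
by rewrite -{1}(odd_double_half n) natrD -mul2n natrM (pcharf0 chK) mul0r addr0.
Qed.

(** A geometric sum; for [c = 1] it is [n], which is 1 in characteristic 2 because [n] is odd. *)
Lemma sum_unity_root_odd (c : K) n :
  odd n -> c ^+ n = 1 -> \sum_(i < n) c ^+ i = (c == 1)%:R.
Proof.
move=> no cn; case: eqP => [->|/eqP c1].
  under eq_bigr do rewrite expr1n.
  by rewrite sumr_const card_ord (natr_pchar2 n) no.
apply: (@mulfI _ (c - 1)); first by rewrite subr_eq0.
by rewrite -subrX1 cn subrr mulr0.
Qed.

(** The sum over all of Z/p^2 minus the sum over the multiples of [p]; each is a geometric sum of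
    odd length. *)
Lemma sum_zeta_unit (z : Z) :
  \sum_(a | a \is a GRing.unit) zeta (a * z) = (z == 0)%:R - (p%:R * z == 0)%:R.
Proof.
have all_sum : \sum_a zeta (a * z) = (z == 0)%:R.
  rewrite sum_Zp -zeta_eq1.
  under eq_bigr do rewrite mulrC zetaM_nat.
  apply: sum_unity_root_odd; first by rewrite oddX p_odd orbT.
  by apply/eqP; rewrite -zetaM_nat (pchar_Zp N_gt1) mulr0 zeta_eq1.
rewrite -{}all_sum [X in _ = X - _](bigID (fun a : Z => a \is a GRing.unit)) /=.
suff -> : \sum_(a | a \isn't a GRing.unit) zeta (a * z) = (p%:R * z == 0)%:R.
  by rewrite addrK.
pose F (a : nat) := if (a%:R : Z) \isn't a GRing.unit then zeta (a%:R * z) else 0.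
(* Writing [a] as [i * p + j] with [j < p], only [j = 0] gives a non-unit. *)
rewrite big_mkcond sum_Zp (sum_ord_mul F (esym (mulnn p))) {}/F.
transitivity (\sum_(i < p) zeta (p%:R * z) ^+ i).
  apply: eq_bigr => i _.
  rewrite (bigD1 (Ordinal p_gt0)) //= big1 ?addr0 => [|j].
    rewrite addn0 natZ_coprime // coprimeMl {2}/coprime gcdnn.
    rewrite gtn_eqF ?prime_gt1 // andbF /=.
    by rewrite -zetaM_nat natrM; congr zeta; ring.
  rewrite -val_eqE /= => j0; rewrite natZ_coprime // coprime_sym /coprime gcdnMDl.
  rewrite -/(coprime _ _) prime_coprime //.
  by rewrite gtnNdvd // lt0n.
rewrite sum_unity_root_odd // ?zeta_eq1 //.
by apply/eqP; rewrite -zetaM_nat mulrAC (mulpp p_pr) mul0r zeta_eq1.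
Qed.

(** Negation preserves levels, so [u + v] may become [u - v]. The first indicator then detects
    [v = u], the second [v] congruent to [u] modulo [p], which happens for exactly one [v] of level
    [l] if [u] is a unit and for none otherwise. *)
Lemma sum_fq_level_zeta_unit (u : Z) l :
  \sum_(v | fq_level p v l) \sum_(a | a \is a GRing.unit) zeta (a * (u + v))
  = (fq_level p u l)%:R - (u \is a GRing.unit)%:R.
Proof.
rewrite (reindex_inj oppr_inj) /=.
under eq_bigl do rewrite (fq_levelN p_pr _ _ p_odd).
under eq_bigr do rewrite sum_zeta_unit.
rewrite sumrB; congr (_ - _).
  case: (boolP (fq_level p u l)) => ul.
    rewrite (bigD1 u) //= subrr eqxx big1 ?addr0 // => v /andP[_ vu].
    by rewrite subr_eq0 eq_sym (negbTE vu).
  rewrite big1 // => v vl; rewrite subr_eq0; case: eqP => // uv.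
  by move: ul; rewrite uv vl.
case: (boolP (u \is a GRing.unit)) => uu.
  rewrite -[RHS](sum_fq_level_congr p_pr l _ uu) big_mkcondr /=.
  by apply: eq_bigr => v _; rewrite mulrBr subr_eq0 eq_sym; case: eqP.
rewrite big1 // => v /(fq_level_unit p_pr); move: uu; rewrite !(unitZE p_pr) negbK.
by rewrite mulrBr => /eqP ->; rewrite sub0r oppr_eq0 => /negbTE ->.
Qed.

Variables (G : Z) (G_prim : (totient N).-primitive_root G).

Lemma totient_sqr : totient N = (p * p.-1)%N.
Proof. by rewrite totient_pfactor // expn1 mulnC. Qed.

Lemma sum_unit_powers (V : nmodType) (F : Z -> V) :
  \sum_(a | a \is a GRing.unit) F a = \sum_(b < totient N) F (G ^+ b).
Proof.
apply: sum_inj_card => [i j /eqP|i|].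
- by rewrite (eq_prim_root_expr G_prim) !modn_small // => /eqP/val_inj.
- exact: unitrX (prim_root_unit G_prim).
rewrite card_ord -sum1_card big_mkcond sum_Zp totient_count_coprime big_mkord.
apply: eq_bigr => i _; rewrite [_ \in _](natZ_coprime p_pr).
by rewrite coprime_pexpl // coprime_sym; case: coprime.
Qed.

(** After the factor [p], powers of [G] have period [p.-1]. The sum over all units thus repeats this
    one [p] times, and [p] is 1 in [K]. *)
Lemma sum_zeta_mulp (u : Z) :
  \sum_(k < p.-1) zeta (u * p%:R * G ^+ k) = (u \is a GRing.unit)%:R.
Proof.
have G1 : p%:R * G ^+ p.-1 = p%:R.
  by apply: (mulIr (prim_root_unit G_prim)); rewrite -mulrA -exprSr prednK // mulp_exprp.
have := sum_zeta_unit (u * p%:R).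
rewrite sum_unit_powers (sum_ord_mul (fun b => zeta (G ^+ b * (u * p%:R))) totient_sqr).
have G1n i : p%:R * G ^+ (i * p.-1) = p%:R.
  by elim: i => [|i IH]; rewrite ?mulr1 // mulSn exprD mulrA G1 IH.
under eq_bigr => i _ do under eq_bigr => j _ do
  rewrite exprD mulrC -mulrA (mulrA p%:R) G1n mulrA.
rewrite sumr_const card_ord -[X in X = _ -> _]mulr_natl (natr_pchar2 p) p_odd mul1r => ->.
rewrite mulrCA (mulpp p_pr) mulr0 eqxx (unitZE p_pr) mulrC.
case: eqP => _; first by rewrite subrr.
by rewrite sub0r (oppr_pchar2 chK).
Qed.

End Character.

(** * The eta coefficients and their sum against the character *)

Section TraceFormula.

Variables (K : fieldType) (iota : {rmorphism 'F_2 -> K}).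
Variables (p : nat) (p_pr : prime p) (p_odd : odd p).
Variables (beta : K) (beta_prim : (p ^ 2)%N.-primitive_root beta).

Local Notation N := (p ^ 2)%N.
Local Notation Z := 'Z_(p ^ 2).
Local Notation zeta := (@zeta K p beta).

Let p_gt0 : (0 < p)%N := prime_gt0 p_pr.
Let N_gt1 : (1 < N)%N := sqr_prime_gt1 p_pr.
Let chK : 2 \in [pchar K].
Proof. by apply: (rmorph_pchar iota); apply: pchar_Fp. Qed.

Lemma eval_fermat_class_poly l :
  eval2 iota (fermat_class_poly p l) beta = \sum_(x | fq_level p x l) zeta x.
Proof.
rewrite /eval2 /fermat_class_poly rmorph_sum horner_sum /=.
rewrite [RHS]big_mkcond (sum_Zp p_pr) big_mkcond.
apply: eq_bigr => i _; rewrite inE fermat_classE //.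
by case: fq_level; rewrite // rmorphXn /= map_polyX hornerXn zeta_nat.
Qed.

(** Multiplication by [a] carries level [l] bijectively onto level [l + j * delta]. *)
Lemma eta_translate delta j (a : Z) : fq_level p a (j * delta) ->
  eta iota p delta beta j
  = \sum_(p.+1./2 <= l < p) \sum_(v | fq_level p v l) zeta (a * v).
Proof.
move=> aj; apply: eq_bigr => l _; rewrite eval_fermat_class_poly.
rewrite (reindex_inj (mulrI (fq_level_unit p_pr aj))) /=.
by apply: eq_bigl => v; rewrite fq_levelMl.
Qed.

Variables (G : Z) (G_prim : (totient N).-primitive_root G).
Variables (delta : nat) (G_lev : fq_level p G delta).

Lemma sum_eta_zeta (u : Z) :
  \sum_(j < p) eta iota p delta beta j * \sum_(k < p.-1) zeta (u * G ^+ (k * p + j))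
  = \sum_(p.+1./2 <= l < p) (fq_level p u l)%:R
    + (p.-1 %/ 2)%:R * (u \is a GRing.unit)%:R.
Proof.
pose H a := \sum_(p.+1./2 <= l < p) \sum_(v | fq_level p v l) zeta (a * v).
(* The level of [G ^+ (k * p + j)] is [(k * p + j) * delta], which is [j * delta] modulo [p]. So
   [eta] at [j] moves inside the sum over [k], and [j], [k] merge into one sum over the units. *)
have etaH (j k : nat) : eta iota p delta beta j = H (G ^+ (k * p + j)).
  apply: eta_translate; rewrite (fq_level_uniq p_pr _ (fq_levelX p_pr _ G_lev)).
  by rewrite mulnDl mulnAC modnMDl.
transitivity (\sum_(a | a \is a GRing.unit) H a * zeta (u * a)).
  rewrite (sum_unit_powers p_pr G_prim).
  have tot : totient N = (p.-1 * p)%N by rewrite totient_sqr // mulnC.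
  rewrite (sum_ord_mul (fun b => H (G ^+ b) * zeta (u * G ^+ b)) tot) exchange_big /=.
  apply: eq_bigr => j _; rewrite mulr_sumr; apply: eq_bigr => k _.
  by rewrite (etaH j k).
transitivity (\sum_(p.+1./2 <= l < p) \sum_(v | fq_level p v l)
    \sum_(a | a \is a GRing.unit) zeta (a * (u + v))).
  under eq_bigr do rewrite mulr_suml.
  rewrite exchange_big /=; apply: eq_bigr => l _.
  under eq_bigr do rewrite mulr_suml.
  rewrite exchange_big /=; apply: eq_bigr => v _; apply: eq_bigr => a _.
  by rewrite -zetaD // mulrDr addrC (mulrC u).
under eq_bigr do rewrite sum_fq_level_zeta_unit //.
(* The range has p - (p+1)/2 = (p-1)/2 levels, and the sign is immaterial in characteristic 2. *)
rewrite sumrB (oppr_pchar2 chK) sumr_const_nat -[_ *+ (_ - _)]mulr_natl.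
congr (_ + _%:R * _).
by move: p_odd; lia.
Qed.

(** * The subgroup generated by [2 ^+ p] and the passage to traces *)

Variables (lambda : nat) (lambda_gt0 : (0 < lambda)%N)
  (lambda_cong : 2 ^ lambda = 1 %[mod p])
  (lambda_min : forall m : nat,
     (0 < m)%N -> 2 ^ m = 1 %[mod p] -> (lambda <= m)%N).

Let h : Z := 2 ^+ p.

(** A [p]-th power depends only on the residue of its base modulo [p], and 2^p is 2 modulo [p].
    Hence [h] in Z/p^2 has the order of 2 modulo [p]. *)
Lemma pow2p_eq1 i : (h ^+ i == 1) = (2 ^ i == 1 %[mod p])%N.
Proof.
rewrite -(mulp_nat_eq p_pr) natrX mulr1.
apply/eqP/eqP => [h1|E].
  by rewrite -(mulp_exprp p_pr) exprAC h1 mulr1.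
rewrite exprAC -[RHS](expr1n _ p).
by apply: (exprp_congr p_pr); rewrite mulr1.
Qed.

Lemma pow2p_prim : lambda.-primitive_root h.
Proof.
have hl : h ^+ lambda = 1 by apply/eqP; rewrite pow2p_eq1 lambda_cong.
have [m prim_m ml] := prim_order_exists lambda_gt0 hl.
suff -> : lambda = m by [].
apply/eqP; rewrite eqn_leq (dvdn_leq lambda_gt0 ml) andbT.
apply: lambda_min; first exact: prim_order_gt0 prim_m.
by apply/eqP; rewrite -pow2p_eq1 (prim_expr_order prim_m).
Qed.

Lemma pow2p_level : fq_level p h 0.
Proof.
have u2 : (2 : Z) \is a GRing.unit.
  by rewrite (natZ_coprime p_pr) coprime2n.
have [q _ q2] := unit_has_level p_pr u2.
have := fq_levelX p_pr p q2; rewrite /fq_level => /eqP ->.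
by rewrite natrM mulrA mulpp // mul0r mulr0.
Qed.

Lemma lambda_dvd : (lambda %| p.-1)%N.
Proof.
rewrite (prim_order_dvd pow2p_prim).
by have := pow2p_level; rewrite /fq_level mulr0 addr0.
Qed.

Lemma prim_powp : p.-1.-primitive_root (G ^+ p).
Proof.
have := exp_prim_root G_prim p.
by rewrite totient_sqr // gcdnMr mulKn.
Qed.

(** If [p] divided [delta], then [G ^+ p.-1] would be 1, against the order [p * p.-1] of [G]. *)
Lemma delta_coprime : coprime p delta.
Proof.
rewrite prime_coprime //; apply/negP => /dvdnP[d dE].
have : G ^+ p.-1 == 1.
  by move: G_lev; rewrite /fq_level dE natrM mulrCA mulpp // mulr0 addr0.
have p1 : (0 < p.-1)%N by have := prime_gt1 p_pr; lia.
rewrite -(prim_order_dvd G_prim) totient_sqr // => /(dvdn_leq p1).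
by have := prime_gt1 p_pr; nia.
Qed.

(** If [h = G ^+ c], then level 0 of [h] means that [p] divides [c * delta], hence [c]. *)
Lemma pow2p_power : exists b, h = (G ^+ p) ^+ b.
Proof.
have hu := fq_level_unit p_pr pow2p_level.
have [c hc] : exists c, h = G ^+ c.
  (* The indicator of [h] has sum at least 1 over the units, but it would sum to 0 over the powers
     of [G] if [h] were not one of them. *)
  have := sum_unit_powers p_pr G_prim (fun a : Z => (a == h) : nat).
  case: (boolP [exists b : 'I_(totient N), h == G ^+ b]).
    by move/existsP => [b /eqP]; exists b.
  move/existsPn => nb.
  rewrite (bigD1 h) //= eqxx [RHS]big1 // => b _.
  by rewrite eq_sym (negbTE (nb b)).
have : fq_level p (G ^+ c) 0 by rewrite -hc; apply: pow2p_level.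
rewrite (fq_level_uniq p_pr _ (fq_levelX p_pr c G_lev)) mod0n -/(dvdn _ _).
rewrite Gauss_dvdl ?delta_coprime // => /dvdnP[b cE].
by exists b; rewrite hc cE mulnC exprM.
Qed.

Lemma sum_trace_powers (V : nmodType) (F : Z -> V) :
  \sum_(k < p.-1 %/ lambda) \sum_(i < lambda) F ((G ^+ p) ^+ k * h ^+ i)
  = \sum_(k < p.-1) F ((G ^+ p) ^+ k).
Proof.
exact: sum_cosets prim_powp pow2p_prim lambda_dvd pow2p_power.
Qed.

Lemma threshold_trace_formula (u : nat) :
  iota (threshold_seq p u) =
    (p.-1 %/ 2)%N%:R *
      (\sum_(k < p.-1 %/ lambda) \sum_(i < lambda)
         zeta (u%:R * p%:R * ((G ^+ p) ^+ k * h ^+ i)))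
    + \sum_(j < p) eta iota p delta beta j *
        (\sum_(k < p.-1 %/ lambda) \sum_(i < lambda)
           zeta (u%:R * G ^+ j * ((G ^+ p) ^+ k * h ^+ i))).
Proof.
rewrite (sum_trace_powers (fun x => zeta (u%:R * p%:R * x))).
under [X in _ + X]eq_bigr => j _.
  rewrite (sum_trace_powers (fun x => zeta (u%:R * G ^+ j * x))).
  under eq_bigr do rewrite -mulrA -exprM -exprD addnC mulnC.
  over.
rewrite sum_eta_zeta.
under eq_bigr => k _ do
  rewrite -mulrA (mulp_congrX k (mulp_exprp p_pr G)) mulrA.
(* Both terms now contribute (p-1)/2 times the indicator that [u] is a unit; the two copies
   cancel. *)
rewrite sum_zeta_mulp // addrCA (addrr_pchar2 chK) addr0.
rewrite threshold_seqE // rmorph_sum.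
by apply: eq_bigr => l _; rewrite rmorph_nat.
Qed.

End TraceFormula.

(* (K, iota) is an algebraic closure of F_2; ^ is the integer power in K. *)
Theorem theorem1
  (K : closedFieldType) (iota : {rmorphism 'F_2 -> K})
  (K_alg : integralRange iota)
  (p : nat) (p_prime : prime p) (p_odd : odd p)
  (g : int) (g_prim : primitive_root_mod (p ^ 2) g)
  (delta : nat) (g_delta : fermat_quotient p g = delta%:Z)
  (beta : K) (beta_prim : (p ^ 2)%N.-primitive_root beta)
  (lambda : nat) (lambda_gt0 : (0 < lambda)%N)
  (lambda_cong : 2 ^ lambda = 1 %[mod p])
  (lambda_min : forall m : nat,
     (0 < m)%N -> 2 ^ m = 1 %[mod p] -> (lambda <= m)%N) :
  (2 ^ p.-1 <> 1 %[mod p ^ 2] ->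
   forall u : nat,
     iota (threshold_seq p u) =
       (p.-1 %/ 2)%N%:R *
         (\sum_(k < p.-1 %/ lambda)
            trace2 lambda 1 (beta ^ (u%:Z * p%:Z * g ^+ k)))
       + \sum_(j < p) eta iota p delta beta j *
           (\sum_(k < p.-1 %/ lambda)
              trace2 (lambda * p) p (beta ^ (u%:Z * g ^+ (k * p + j)))))
  /\
  (2 ^ p.-1 = 1 %[mod p ^ 2] ->
   forall u : nat,
     iota (threshold_seq p u) =
       (p.-1 %/ 2)%N%:R *
         (\sum_(k < p.-1 %/ lambda)
            trace2 lambda 1 (beta ^ (u%:Z * p%:Z * g ^+ k)))
       + \sum_(j < p) eta iota p delta beta j *
           (\sum_(k < p.-1 %/ lambda)
              trace2 lambda 1 (beta ^ (u%:Z * g ^+ (k * p + j))))).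
Proof.
have p_gt0 := prime_gt0 p_prime.
set G : 'Z_(p ^ 2) := g%:~R.
have G_prim : (totient (p ^ 2)).-primitive_root G := g_prim.
have G_lev : fq_level p G delta.
  apply: fermat_quotient_level g_delta => //.
  exact: prim_root_unit G_prim.
have formula := threshold_trace_formula iota p_prime p_odd beta_prim G_prim G_lev
  lambda_gt0 lambda_cong lambda_min.
(* Raising to the power 2^(ik) becomes multiplication by [(2 ^+ k) ^+ i] inside the character. *)
have trE n k (z : int) : trace2 n k (beta ^ z)
    = \sum_(i < n %/ k) zeta beta (z%:~R * (2 ^+ k) ^+ i : 'Z_(p ^ 2)).
  apply: eq_bigr => i _.
  by rewrite (zeta_int p_prime beta_prim) -zetaM_nat // natrX mulnC exprM.
(* The factor [p] allows 2 and [G] to be replaced by their [p]-th powers. *)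
have trace_p u k : trace2 lambda 1 (beta ^ (u%:Z * p%:Z * g ^+ k))
    = \sum_(i < lambda) zeta beta
        (u%:R * p%:R * ((G ^+ p) ^+ k * (2 ^+ p) ^+ i) : 'Z_(p ^ 2)).
  rewrite trE divn1; apply: eq_bigr => i _; congr zeta.
  rewrite !rmorphM /= rmorphXn /= -/G -!pmulrn expr1.
  rewrite -!mulrA; congr (_ * _).
  rewrite !mulrA (mulp_congrX k (mulp_exprp p_prime G)).
  by rewrite ![_ * G ^+ k]mulrC -!mulrA (mulp_congrX i (mulp_exprp p_prime 2)).
have trace_u u (j k : nat) (h : 'Z_(p ^ 2)) n : h = 2 ^+ p ->
    \sum_(i < n) zeta beta ((u%:Z * g ^+ (k * p + j))%:~R * h ^+ i)
    = \sum_(i < n) zeta beta (u%:R * G ^+ j * ((G ^+ p) ^+ k * (2 ^+ p) ^+ i)).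
  move=> ->; apply: eq_bigr => i _; congr zeta.
  rewrite rmorphM /= rmorphXn /= -/G -pmulrn addnC mulnC exprD exprM.
  by rewrite !mulrA.
split=> wieferich u; rewrite formula; congr (_ * _ + _);
  try by apply: eq_bigr => k _; rewrite trace_p.
- apply: eq_bigr => j _; congr (_ * _); apply: eq_bigr => k _.
  by rewrite trE mulnK // trace_u.
- apply: eq_bigr => j _; congr (_ * _); apply: eq_bigr => k _.
  (* The trace to the prime field has step 2, which equals [2 ^+ p] since [2 ^+ p.-1 = 1] here. *)
  rewrite trE divn1 trace_u // expr1 -[X in _ ^+ X](prednK p_gt0) exprS.
  have -> : 2 ^+ p.-1 = 1 :> 'Z_(p ^ 2).
    by rewrite -natrX; apply/eqP; rewrite (natZ_eq p_prime _ 1); apply/eqP.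
  by rewrite mulr1.
Qed.
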